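(* Assume that the ALS parameter sequence $(\mathbf p_k)_{k\in\mathbb N}$ satisfies assumption (A2) below. Then every accumulation point of the sequence $(v_k)_{k\in\mathbb N}$ of represented tensors belongs to the set $\mathfrak M$ of critical points, and $$\operatorname{dist}(v_k,\mathfrak M):=\inf_{w\in\mathfrak M}\|v_k-w\|\xrightarrow[k\to\infty]{}0 .$$
   Context: Let $d\ge 1$ and $m_1,\dots,m_d$ be positive integers, $N=\prod_{\nu=1}^d m_\nu$, and $\mathcal V=\bigotimes_{\nu=1}^d\mathbb R^{m_\nu}\cong\mathbb R^N$ with the Euclidean inner product $\langle\cdot,\cdot\rangle$ and norm $\|\cdot\|$. Let $A\in\mathbb R^{N\times N}$ be symmetric positive definite and $b\in\mathcal V\setminus\{0\}$; put $f(v)=\frac{1}{\|b\|^2}\big(\tfrac12\langle Av,v\rangle-\langle b,v\rangle\big)$. A tensor format representation consists of an integer $L\ge d$, finite-dimensional real inner product spaces $P_1,\dots,P_L$, the parameter space $P=P_1\times\dots\times P_L$ (with product inner product and norm), and a multilinear map $U:P\to\mathcal V$; put $F=f\circ U$. For $\mathbf p=(p_1,\dots,p_L)\in P$ and $\mu\in\{1,\dots,L\}$ let $\mathbf p^{[\mu]}=(p_1,\dots,p_{\mu-1},p_{\mu+1},\dots,p_L)$ and let $W_{\mu,\mathbf p^{[\mu]}}:P_\mu\to\mathcal V$ be the linear map $q\mapsto U(p_1,\dots,p_{\mu-1},q,p_{\mu+1},\dots,p_L)$. Linear maps are identified with matrices w.r.t. fixed orthonormal bases; $X^T$ is the transpose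 (adjoint), $X^+$ the Moore–Penrose pseudoinverse. ALS: choose $\mathbf p_1=(p_1^1,\dots,p_L^1)\in P$. For $k=1,2,\dots$ and $\mu=1,\dots,L$ in this order let $W_{k,\mu}:=W_{\mu,(p_1^{k+1},\dots,p_{\mu-1}^{k+1},p_{\mu+1}^k,\dots,p_L^k)}$, $G_{k,\mu}:=W_{k,\mu}^TAW_{k,\mu}$ and $p_\mu^{k+1}:=G_{k,\mu}^+W_{k,\mu}^Tb$ (the minimum-norm minimiser of $q\mapsto F(p_1^{k+1},\dots,p_{\mu-1}^{k+1},q,p_{\mu+1}^k,\dots,p_L^k)$). Put $\mathbf p_k=(p_1^k,\dots,p_L^k)$, $v_k=U(\mathbf p_k)$, and for $\mu\in\{0,\dots,L\}$, $\mathbf p_{k,\mu}=(p_1^{k+1},\dots,p_\mu^{k+1},p_{\mu+1}^k,\dots,p_L^k)$. Critical points: $\mathfrak M=\{v\in\mathcal V:\exists\,\mathbf p\in P \text{ with } v=U(\mathbf p)\text{ and } F'(\mathbf p)=0\}$. Assumption (A2): $(\mathbf p_k)_k$ is bounded, and for every infinite $J\subseteq\mathbb N$ the following holds: let $\mathrm{Ap}_J$ be the set of all accumulation points of the sequences $(\mathbf p_{k,\mu})_{k\in J}$, $\mu=0,\dots,L-1$, and let $\mathbf p^*=(p_1^*,\dots,p_L^* )\in\mathrm{Ap}_J$ be an element of minimal norm in $\mathrm{Ap}_J$; then for every $\mu\in\{1,\dots,L\}$ there is $k_0\in J$ such that $\operatorname{rank}W_{k,\mu}=\operatorname{rank}W_{\mu,\mathbf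 p^{*[\mu]}}$ for all $k\in J$ with $k\ge k_0$. *)

(* Defs.v *)
From HB Require Import structures.
From mathcomp Require Import all_boot all_order all_algebra.
From mathcomp Require Import reals.
Set Implicit Arguments. Unset Strict Implicit. Unset Printing Implicit Defensive.
Import Order.TTheory GRing.Theory Num.Theory.
Local Open Scope ring_scope.

Section ALS.
Variable R : realType.

Definition ip k (x y : 'cV[R]_k) : R := (x^T *m y) 0 0.
Definition vnorm k (x : 'cV[R]_k) : R := Num.sqrt (ip x x).

Variables (L : nat) (n : 'I_L -> nat).
Definition param := forall mu : 'I_L, 'cV[R]_(n mu).
Definition padd (p q : param) : param := fun mu => p mu + q mu.
Definition psub (p q : param) : param := fun mu => p mu - q mu.
Definition pnorm (p : param) : R := Num.sqrt (\sum_(mu < L) ip (p mu) (p mu)).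

Definition pwith (p : param) (mu : 'I_L) (q : 'cV[R]_(n mu)) : param :=
  @dfwith _ (fun i => 'cV[R]_(n i)) p mu q.
Arguments pwith p mu q : clear implicits.

Variable N : nat.

Definition multilinear (U : param -> 'cV[R]_N) : Prop :=
  forall (p : param) (mu : 'I_L) (a : R) (q1 q2 : 'cV[R]_(n mu)),
    U (pwith p mu (a *: q1 + q2)) = a *: U (pwith p mu q1) + U (pwith p mu q2).

(* matrix of W_{mu, p^[mu]} : q |-> U(p_1,..,p_{mu-1},q,p_{mu+1},..,p_L)
   w.r.t. the standard (orthonormal) bases; it only depends on p^[mu]. *)
Definition Wmat (U : param -> 'cV[R]_N) (mu : 'I_L) (p : param) : 'M[R]_(N, n mu) :=
  \matrix_(i < N, j < n mu) (U (pwith p mu (delta_mx j 0))) i 0.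

Definition is_MPinv r c (G : 'M[R]_(r, c)) (X : 'M[R]_(c, r)) : Prop :=
  [/\ G *m X *m G = G, X *m G *m X = X, (G *m X)^T = G *m X & (X *m G)^T = X *m G].

Definition fobj (A : 'M[R]_N) (b : 'cV[R]_N) (v : 'cV[R]_N) : R :=
  (ip b b)^-1 * (2^-1 * ip (A *m v) v - ip b v).
Definition Fobj A b (U : param -> 'cV[R]_N) (p : param) : R := fobj A b (U p).

(* F'(p) = 0 : F is (Frechet) differentiable at p with zero derivative *)
Definition critical_param (F : param -> R) (p : param) : Prop :=
  forall eps : R, 0 < eps -> exists2 delta : R, 0 < delta &
    forall h : param, pnorm h < delta -> `|F (padd p h) - F p| <= eps * pnorm h.

Definition critset A b (U : param -> 'cV[R]_N) (v : 'cV[R]_N) : Prop :=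
  exists p : param, v = U p /\ critical_param (Fobj A b U) p.

(* p_{k,mu} = (p_1^{k+1},..,p_mu^{k+1},p_{mu+1}^k,..,p_L^k), 0-based components *)
Definition pkmu (ps : nat -> param) (k mu : nat) : param :=
  fun nu => if (nu < mu)%N then ps k.+1 nu else ps k nu.

(* W_{k,mu} (mu 1-based in the paper = nu.+1 here, nu : 'I_L) *)
Definition Wkmu U (ps : nat -> param) (k : nat) (nu : 'I_L) : 'M[R]_(N, n nu) :=
  Wmat U nu (pkmu ps k nu).

Definition ALS_seq A b U (ps : nat -> param) : Prop :=
  forall (k : nat) (nu : 'I_L), (1 <= k)%N ->
    let W := Wkmu U ps k nu in
    exists X : 'M[R]_(n nu),
      is_MPinv (W^T *m A *m W) X /\ ps k.+1 nu = X *m (W^T *m b).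

Definition acc_param (J : nat -> bool) (s : nat -> param) (x : param) : Prop :=
  forall eps : R, 0 < eps -> forall K : nat,
    exists k, [/\ J k, (K <= k)%N & pnorm (psub (s k) x) < eps].

Definition ApJ (ps : nat -> param) (J : nat -> bool) (x : param) : Prop :=
  exists mu : 'I_L, acc_param J (fun k => pkmu ps k mu) x.

Definition infinite_nat (J : nat -> bool) : Prop :=
  forall K : nat, exists k, (K <= k)%N /\ J k.

Definition A2 U (ps : nat -> param) : Prop :=
  (exists C : R, forall k, (1 <= k)%N -> pnorm (ps k) <= C) /\
  forall J : nat -> bool, (forall k, J k -> (1 <= k)%N) -> infinite_nat J ->
  forall pstar : param, ApJ ps J pstar ->
    (forall q : param, ApJ ps J q -> pnorm pstar <= pnorm q) ->
    forall nu : 'I_L, exists k0, J k0 /\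
      forall k, J k -> (k0 <= k)%N ->
        \rank (Wkmu U ps k nu) = \rank (Wmat U nu pstar).

Definition acc_vec (v : nat -> 'cV[R]_N) (w : 'cV[R]_N) : Prop :=
  forall eps : R, 0 < eps -> forall K : nat,
    exists k, [/\ (1 <= k)%N, (K <= k)%N & vnorm (v k - w) < eps].

End ALS.

(* Main.v *)
(* Each micro-step decreases [F] by a multiple of the squared [A]-norm of the
   change of the tensor, so along any convergent subsequence all the [p_(k,mu)]
   have limits representing the same tensor.  Given an accumulation point [w] of
   [v_k], let [x] have minimal norm among the accumulation points of the
   [p_(k,mu)] with [U x = w].  If [p_(k,mu)] tends to [x] along [J], then [x] is
   also of minimal norm in [Ap_J], so (A2) gives constant rank; hence the limit of
   the updated components is the minimum-norm minimiser of the limit problem, and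
   minimality of [x] forces it to be the old component of [x].  Thus
   [p_(k,mu+1)] tends to [x] as well and the partial gradient at [x] vanishes;
   running once through all components shows that [x] is critical. *)
Require Import Defs.
From HB Require Import structures.
From mathcomp Require Import all_boot all_order all_algebra.
From mathcomp Require Import reals.
From mathcomp Require Import boolp classical_sets filter topology.
From mathcomp Require Import normedtype sequences realfun.
From mathcomp Require Import ring lra.
Set Implicit Arguments. Unset Strict Implicit. Unset Printing Implicit Defensive.
Import Order.TTheory GRing.Theory Num.Theory numFieldNormedType.Exports.
Local Open Scope ring_scope.

(** * Entrywise limits of matrices along a filter *)

Section MatrixConvergence.
Local Open Scope classical_set_scope.
Context {R : realType} {T : Type} {F : set_system T} {FF : Filter F}.

Lemma cvg_sumr (I : Type) (r : seq I) (P : pred I) (f : I -> T -> R) (l : I -> R) :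
  (forall i, P i -> f i t @[t --> F] --> l i) ->
  \sum_(i <- r | P i) f i t @[t --> F] --> \sum_(i <- r | P i) l i.
Proof. by move=> fl; apply: cvg_big => //; exact: add_continuous. Qed.

Lemma cvg_prodr (I : Type) (r : seq I) (P : pred I) (f : I -> T -> R) (l : I -> R) :
  (forall i, P i -> f i t @[t --> F] --> l i) ->
  \prod_(i <- r | P i) f i t @[t --> F] --> \prod_(i <- r | P i) l i.
Proof. by move=> fl; apply: cvg_big => //; exact: mul_continuous. Qed.

(** Working entry by entry reduces matrix limits to sums and products of limits in [R]. *)
Definition mcvg m n (M : T -> 'M[R]_(m, n)) (l : 'M[R]_(m, n)) : Prop :=
  forall i j, M t i j @[t --> F] --> l i j.

Lemma mcvg_cst m n (M : 'M[R]_(m, n)) : mcvg (fun=> M) M.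
Proof. by move=> i j; exact: cvg_cst. Qed.

Lemma mcvgD m n (M1 M2 : T -> 'M[R]_(m, n)) l1 l2 :
  mcvg M1 l1 -> mcvg M2 l2 -> mcvg (fun t => M1 t + M2 t) (l1 + l2).
Proof.
by move=> c1 c2 i j; under eq_fun do rewrite mxE; rewrite mxE; exact: cvgD.
Qed.

Lemma mcvgZ m n (a : T -> R) (M : T -> 'M[R]_(m, n)) (la : R) l :
  a t @[t --> F] --> la -> mcvg M l -> mcvg (fun t => a t *: M t) (la *: l).
Proof.
by move=> c1 c2 i j; under eq_fun do rewrite mxE; rewrite mxE; exact: cvgM.
Qed.

Lemma mcvgB m n (M1 M2 : T -> 'M[R]_(m, n)) l1 l2 :
  mcvg M1 l1 -> mcvg M2 l2 -> mcvg (fun t => M1 t - M2 t) (l1 - l2).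
Proof.
by move=> c1 c2 i j; under eq_fun do rewrite !mxE; rewrite !mxE; exact: cvgB.
Qed.

Lemma mcvgT m n (M : T -> 'M[R]_(m, n)) l : mcvg M l -> mcvg (fun t => (M t)^T) l^T.
Proof. by move=> c i j; under eq_fun do rewrite mxE; rewrite mxE; exact: c. Qed.

Lemma mcvgM m n p (M1 : T -> 'M[R]_(m, n)) (M2 : T -> 'M[R]_(n, p)) l1 l2 :
  mcvg M1 l1 -> mcvg M2 l2 -> mcvg (fun t => M1 t *m M2 t) (l1 *m l2).
Proof.
move=> c1 c2 i j; under eq_fun do rewrite mxE; rewrite mxE.
by apply: cvg_sumr => k _; exact: cvgM.
Qed.

Lemma cvg_det n (M : T -> 'M[R]_n) l : mcvg M l -> \det (M t) @[t --> F] --> \det l.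
Proof.
move=> c; apply: cvg_sumr => s _; apply: cvgM; first exact: cvg_cst.
by apply: cvg_prodr => i _; exact: c.
Qed.

Lemma mcvg_adj n (M : T -> 'M[R]_n) l :
  mcvg M l -> mcvg (fun t => \adj (M t)) (\adj l).
Proof.
move=> c i j; under eq_fun do rewrite mxE; rewrite mxE.
apply: cvgM; first exact: cvg_cst.
apply: cvg_det => i' j'; under eq_fun do rewrite !mxE.
by rewrite !mxE; exact: c.
Qed.

Lemma mcvg_mxsub m n m' n' (f : 'I_m' -> 'I_m) (g : 'I_n' -> 'I_n)
    (M : T -> 'M[R]_(m, n)) l :
  mcvg M l -> mcvg (fun t => mxsub f g (M t)) (mxsub f g l).
Proof. by move=> c i j; under eq_fun do rewrite mxE; rewrite mxE; exact: c. Qed.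

Lemma cvg_ip k (x y : T -> 'cV[R]_k) lx ly :
  mcvg x lx -> mcvg y ly -> ip (x t) (y t) @[t --> F] --> ip lx ly.
Proof. by move=> cx cy; apply: mcvgM => //; exact: mcvgT. Qed.

Lemma mcvg_near m n (M1 M2 : T -> 'M[R]_(m, n)) l :
  (\forall t \near F, M1 t = M2 t) -> mcvg M1 l -> mcvg M2 l.
Proof.
move=> e c i j; apply: cvg_trans (c i j); apply: near_eq_cvg.
by apply: filterS e => t ->.
Qed.

End MatrixConvergence.
Arguments mcvg {R T} F {m n} M l.

(** * Limits of bounded functions along an ultrafilter *)

Section UltraConvergence.
Local Open Scope classical_set_scope.
Context {R : realType} {T : Type}.
Implicit Types F G : set_system T.

Lemma mcvg_unique F {PF : ProperFilter F} m n (M : T -> 'M[R]_(m, n)) l1 l2 :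
  mcvg F M l1 -> mcvg F M l2 -> l1 = l2.
Proof. by move=> c1 c2; apply/matrixP => i j; exact: norm_cvg_unique (c1 i j) (c2 i j). Qed.

(** Along one fixed ultrafilter all bounded sequences converge at once, which replaces repeated
    extraction of subsequences. *)
Lemma ultra_cvg F {UF : UltraFilter F} (u : T -> R) C :
  (\forall t \near F, `|u t| <= C) -> exists l : R, u t @[t --> F] --> l.
Proof.
move=> uC; have := @segment_compact R (- C) C; rewrite compact_ultra.
have Uu : ProperFilter (u @ F) by exact: fmap_proper_filter.
have [G [UG uG]] := ultraFilterLemma Uu.
move=> /(_ G UG) [|l [_ Gl]].
  by apply: uG; apply: filterS uC => t /=; rewrite in_itv /= ler_norml.
(* If the preimage of [A] were not in [F], its complement would be, and then both [A] and its
   complement would lie in [G]. *)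
exists l => A /Gl GA; have [//|nA] := in_ultra_setVsetC (u @^-1` A) UF.
have : G (A `&` ~` A) by apply: filterI => //; exact: uG.
by move=> /filter_ex [x []].
Qed.

Lemma ultra_mcvg F {UF : UltraFilter F} m n (M : T -> 'M[R]_(m, n)) C :
  (\forall t \near F, forall i j, `|M t i j| <= C) -> exists l, mcvg F M l.
Proof.
move=> MC; have H i j : exists l : R, M t i j @[t --> F] --> l.
  by apply: (@ultra_cvg _ _ _ C); apply: filterS MC.
have [f fP] := fin_all_exists (fun i => fin_all_exists (H i)).
by exists (\matrix_(i, j) f i j) => i j; rewrite mxE; exact: fP.
Qed.

End UltraConvergence.

(** * Euclidean inner product and Gram determinants *)

Section InnerProduct.
Context {R : realType}.

Lemma ipE k (x y : 'cV[R]_k) : ip x y = \sum_i x i 0 * y i 0.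
Proof. by rewrite /ip mxE; apply: eq_bigr => i _; rewrite mxE. Qed.

Lemma ipC k (x y : 'cV[R]_k) : ip x y = ip y x.
Proof. by rewrite !ipE; apply: eq_bigr => i _; rewrite mulrC. Qed.

Lemma ipDl k (x y z : 'cV[R]_k) : ip (x + y) z = ip x z + ip y z.
Proof. by rewrite /ip linearD mulmxDl mxE. Qed.

Lemma ipBl k (x y z : 'cV[R]_k) : ip (x - y) z = ip x z - ip y z.
Proof. by rewrite /ip linearB mulmxBl !mxE. Qed.

Lemma ipDr k (x y z : 'cV[R]_k) : ip z (x + y) = ip z x + ip z y.
Proof. by rewrite !(ipC z) ipDl. Qed.

Lemma ipBr k (x y z : 'cV[R]_k) : ip z (x - y) = ip z x - ip z y.
Proof. by rewrite !(ipC z) ipBl. Qed.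

Lemma ipZl k (a : R) (x z : 'cV[R]_k) : ip (a *: x) z = a * ip x z.
Proof. by rewrite /ip linearZ /= -scalemxAl mxE. Qed.

Lemma ip_sumr k (I : Type) (r : seq I) (z : 'cV[R]_k) (f : I -> 'cV[R]_k) :
  ip z (\sum_(i <- r) f i) = \sum_(i <- r) ip z (f i).
Proof. by rewrite /ip mulmx_sumr summxE. Qed.

Lemma ip0r k (x : 'cV[R]_k) : ip x 0 = 0.
Proof. by rewrite /ip mulmx0 mxE. Qed.

Lemma ip_mul k l (M : 'M[R]_(k, l)) x y : ip (M *m x) y = ip x (M^T *m y).
Proof. by rewrite /ip trmx_mul mulmxA. Qed.

Lemma ip_ge0 k (x : 'cV[R]_k) : 0 <= ip x x.
Proof. by rewrite ipE; apply: sumr_ge0 => i _; rewrite -expr2 sqr_ge0. Qed.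

Lemma ip_eq0 k (x : 'cV[R]_k) : ip x x = 0 -> x = 0.
Proof.
rewrite ipE => /eqP; rewrite psumr_eq0 => [/allP x0|i _]; last first.
  by rewrite -expr2 sqr_ge0.
apply/matrixP => i j; rewrite ord1 mxE; apply/eqP.
by have := x0 i (mem_index_enum _); rewrite /= mulf_eq0 orbb.
Qed.

Lemma ip_gt0 k (x : 'cV[R]_k) : x != 0 -> 0 < ip x x.
Proof. by move=> x0; rewrite lt0r ip_ge0 andbT; apply: contra_neq x0 => /ip_eq0. Qed.

Lemma normr_le_vnorm k (x : 'cV[R]_k) i j : `|x i j| <= vnorm x.
Proof.
rewrite ord1 -(ler_pXn2r (n := 2))// ?nnegrE ?sqrtr_ge0// sqr_sqrtr ?ip_ge0//.
rewrite real_normK ?num_real// ipE (bigD1 i)//= -expr2 lerDl.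
by apply: sumr_ge0 => l _; rewrite -expr2 sqr_ge0.
Qed.

(** If [v *m B *m B^T = 0], then [v *m B] has norm zero, so [B] and its Gram matrix have the same
    left kernel. *)
Lemma det_gram k n (B : 'M[R]_(k, n)) : (\det (B *m B^T) != 0) = row_free B.
Proof.
rewrite -unitfE -[_ \is a _]/(_ \in unitmx) -row_free_unit.
apply/idP/idP => fB; apply: inj_row_free => v v0.
  by apply: (row_free_inj fB); rewrite mul0mx mulmxA v0 mul0mx.
apply: (row_free_inj fB); rewrite mul0mx; apply/trmx_inj; rewrite trmx0.
by apply: ip_eq0; rewrite /ip trmxK trmx_mul mulmxA -(mulmxA v) v0 mul0mx mxE.
Qed.

End InnerProduct.

(** * Row spaces under limits of constant rank *)

Section RowSpaceLimit.
Local Open Scope classical_set_scope.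
Context {R : realType} {T : Type} {F : set_system T} {FF : ProperFilter F}.

(* At constant rank, a maximal set of independent rows of the limit spans the
   row space of nearby matrices too, and the orthogonal projector onto their
   span, up to the factor [\det (B *m B^T)], is polynomial in the entries. *)
Lemma row_space_limit m n (W : T -> 'M[R]_(m, n)) Ws (q : T -> 'cV[R]_n) qs :
  mcvg F W Ws -> mcvg F q qs ->
  (\forall t \near F, \rank (W t) = \rank Ws) ->
  (\forall t \near F, exists y, q t = (W t)^T *m y) ->
  exists y, qs = Ws^T *m y.
Proof.
move=> cW cq rkW qW; pose f := maxrankfun Ws.
pose B t := rowsub f (W t); pose Bs := rowsub f Ws.
have cB : mcvg F B Bs by exact: mcvg_mxsub.
have cD : mcvg F (fun t => B t *m (B t)^T) (Bs *m Bs^T).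
  exact: mcvgM (mcvgT cB).
have fBs : \det (Bs *m Bs^T) != 0 by rewrite det_gram; exact: maxrowsub_free.
have fB : \forall t \near F, \det (B t *m (B t)^T) != 0.
  by apply: cvgr_neq0 fBs; exact: cvg_det.
have Bq : \forall t \near F, (B t)^T *m \adj (B t *m (B t)^T) *m B t *m q t
                             = \det (B t *m (B t)^T) *: q t.
  apply: filterS3 fB rkW qW => t; rewrite det_gram => fBt rkWt [y qy].
  have BW : (B t <= W t)%MS by rewrite /B rowsubE submxMl.
  (* Equality of ranks turns the inclusion of row spaces into an equality. *)
  have WB : (W t <= B t)%MS.
    by rewrite -(mxrank_leqif_sup BW) rkWt.
  have [c ec] := submxP WB.
  have -> : q t = (B t)^T *m (c^T *m y) by rewrite qy ec trmx_mul mulmxA.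
  move: (c^T *m y) => z.
  by rewrite -!mulmxA (mulmxA (B t)) (mulmxA (\adj _)) mul_adj_mx mul_scalar_mx scalemxAr.
have E : Bs^T *m \adj (Bs *m Bs^T) *m Bs *m qs = \det (Bs *m Bs^T) *: qs.
  apply: (@mcvg_unique _ _ F); last exact: mcvgZ (cvg_det cD) cq.
  apply: mcvg_near Bq _; apply: mcvgM cq; apply: (mcvgM _ cB).
  by apply: mcvgM; [exact: mcvgT|exact: mcvg_adj].
have Q : qs = Bs^T *m ((\det (Bs *m Bs^T))^-1 *: (\adj (Bs *m Bs^T) *m Bs *m qs)).
  by rewrite -scalemxAr !mulmxA E scalerA mulVf// scale1r.
move: Q; move: (_ *: _) => z ->.
by exists ((rowsub f 1%:M)^T *m z); rewrite /Bs rowsubE trmx_mul mulmxA.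
Qed.

End RowSpaceLimit.

(** * Least squares in the energy norm of [A] *)

Section LeastSquares.
Context {R : realType} {N : nat} (A : 'M[R]_N) (b : 'cV[R]_N).
Hypothesis Asym : A^T = A.
Hypothesis Apos : forall v : 'cV[R]_N, v != 0 -> 0 < ip (A *m v) v.

Lemma ipA_ge0 v : 0 <= ip (A *m v) v.
Proof. by have [->|/Apos/ltW//] := eqVneq v 0; rewrite ip0r. Qed.

Lemma ipA_eq0 v : ip (A *m v) v = 0 -> v = 0.
Proof. by move=> v0; apply/eqP; apply: contra_eqT v0 => /Apos; rewrite lt0r => /andP[]. Qed.

Section MoorePenrose.
Context {k : nat} (W : 'M[R]_(N, k)) (X : 'M[R]_k).
Hypothesis WX : is_MPinv (W^T *m A *m W) X.

Let Gsym : (W^T *m A *m W)^T = W^T *m A *m W.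
Proof. by rewrite !trmx_mul trmxK Asym mulmxA. Qed.

(** Since [G *m X] is the orthogonal projector onto the range of [G], the residual [y] lies in the
    kernel of [G], which is the kernel of [W] because [A] is positive definite. Hence [y] is
    orthogonal to both of its own terms and vanishes. *)
Lemma MPinv_normal_eq : W^T *m (A *m (W *m (X *m (W^T *m b))) - b) = 0.
Proof.
have [GXG _ GX _] := WX; move: GXG GX Gsym; set G := _ *m A *m W => GXG GX GT.
pose y := W^T *m b - G *m X *m (W^T *m b).
have Gy : G *m y = 0.
  have GGX : G *m (G *m X) = G.
    by rewrite -GX; apply: trmx_inj; rewrite trmx_mul trmxK GT GXG.
  by rewrite /y mulmxBr (mulmxA G (G *m X)) GGX subrr.
have Wy : W *m y = 0.
  by apply: ipA_eq0; rewrite ipC ip_mul !mulmxA -/G Gy ip0r.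
have y0 : y = 0.
  apply: ip_eq0; rewrite {2}/y ipBr -ip_mul Wy -mulmxA -{1}GT -ip_mul Gy.
  by rewrite !(ipC 0) !ip0r subrr.
by rewrite mulmxBr !mulmxA -/G -[LHS]opprB -[RHS]oppr0 -y0 /y !mulmxA.
Qed.

(** The Penrose identities give [X = G *m X^T *m X], and [G] starts with [W^T]. This is how the
    minimum-norm property of the update enters: the range of [W^T] is orthogonal to the kernel of
    [W]. *)
Lemma MPinv_row_space (c : 'cV[R]_k) : exists y, X *m c = W^T *m y.
Proof.
have [_ XGX _ XG] := WX.
exists (A *m (W *m (X^T *m (X *m c)))).
by rewrite -{1}XGX -XG trmx_mul Gsym !mulmxA.
Qed.

End MoorePenrose.

(** In the quadratic expansion about [v'] the linear term vanishes, because the gradient at [v'] is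
    orthogonal to the range of [W], which contains [v' - v]. *)
Lemma fobjB k (W : 'M[R]_(N, k)) h v v' :
  W^T *m (A *m v' - b) = 0 -> v' - v = W *m h ->
  fobj A b v - fobj A b v' = (ip b b)^-1 * (2^-1 * ip (A *m (v' - v)) (v' - v)).
Proof.
move=> g0 vh.
have o : ip (A *m v' - b) (v' - v) = 0 by rewrite vh ipC ip_mul g0 ip0r.
have s : ip (A *m v) v' = ip (A *m v') v by rewrite ip_mul Asym ipC.
move: o; rewrite /fobj mulmxBr !(ipBl, ipBr) s => o.
rewrite -mulrBr; congr (_ * _).
set a := ip (A *m v') v' in o *; set c := ip (A *m v') v in o *.
set e := ip b v' in o *; set g := ip b v in o *.
by lra.
Qed.

(** The value at the solution of [A v = b] is a lower bound, by [fobjB] with the identity for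
    [W]. *)
Lemma fobj_bounded : exists c, forall v, c <= fobj A b v.
Proof.
have uA : A \in unitmx.
  rewrite -row_free_unit; apply: inj_row_free => v vA.
  apply/trmx_inj; rewrite trmx0; apply: ipA_eq0.
  by rewrite ip_mul Asym -[in A *m _]Asym -trmx_mul vA trmx0 ip0r.
exists (fobj A b (invmx A *m b)) => v.
rewrite -subr_ge0 (@fobjB _ 1%:M (invmx A *m b - v)) ?mul1mx//.
  by rewrite mulr_ge0 ?invr_ge0 ?ip_ge0// mulr_ge0 ?invr_ge0// ipA_ge0.
by rewrite mulKVmx// subrr mulmx0.
Qed.

End LeastSquares.

(** * Convergence of parameter tuples and continuity of multilinear maps *)

Section ParameterTuples.
Local Open Scope classical_set_scope.
Context {R : realType} {L : nat} {n : 'I_L -> nat}.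
Local Notation P := (@param R L n).
Implicit Types p x : P.
Local Arguments pwith {R L n} p mu q.

Lemma pwith_in p mu q : pwith p mu q mu = q.
Proof. exact: dfwith_in. Qed.

Lemma pwith_out p mu q nu : mu != nu -> pwith p mu q nu = p nu.
Proof. exact: dfwith_out. Qed.

Lemma pwith_eq p p' mu q :
  p' mu = q -> (forall nu, mu != nu -> p' nu = p nu) -> pwith p mu q = p'.
Proof.
move=> <- pp'; apply: functional_extensionality_dep => nu.
by case: (eqVneq mu nu) => [<-|mn]; rewrite ?pwith_in// pwith_out// pp'.
Qed.

Lemma pwith_id p mu : pwith p mu (p mu) = p.
Proof. exact: pwith_eq. Qed.

Lemma pnorm_sqr p : pnorm p ^+ 2 = \sum_(mu < L) ip (p mu) (p mu).
Proof. by rewrite sqr_sqrtr// sumr_ge0// => mu _; exact: ip_ge0. Qed.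

Lemma pnorm_ge0 p : 0 <= pnorm p.
Proof. exact: sqrtr_ge0. Qed.

Lemma normr_le_pnorm p mu i j : `|p mu i j| <= pnorm p.
Proof.
rewrite ord1 -(ler_pXn2r (n := 2))// ?nnegrE ?pnorm_ge0// pnorm_sqr real_normK ?num_real//.
rewrite (bigD1 mu)//= ipE (bigD1 i)//= -expr2 -addrA lerDl addr_ge0//.
  by apply: sumr_ge0 => k _; rewrite -expr2 sqr_ge0.
by apply: sumr_ge0 => k _; exact: ip_ge0.
Qed.

Lemma pnorm_psubxx x : pnorm (psub x x) = 0.
Proof. by rewrite /pnorm big1 ?sqrtr0// => mu _; rewrite /psub subrr ip0r. Qed.

Definition pcvg T (F : set_system T) (s : T -> P) x : Prop :=
  forall mu, mcvg F (fun t => s t mu) (x mu).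

Lemma pcvg_unique T (F : set_system T) {PF : ProperFilter F} s x y :
  pcvg F s x -> pcvg F s y -> x = y.
Proof.
move=> sx sy; apply: functional_extensionality_dep => mu.
exact: mcvg_unique (sx mu) (sy mu).
Qed.

Section PCvg.
Context {T : Type} {F : set_system T} {FF : Filter F}.

Lemma cvg_pnorm (s : T -> P) x : pcvg F s x -> pnorm (s t) @[t --> F] --> pnorm x.
Proof.
move=> sx; apply: (@continuous_cvg _ _ _ F _ _ Num.sqrt); first exact: sqrt_continuous.
by apply: cvg_sumr => mu _; exact: cvg_ip.
Qed.

Lemma cvg_pnorm_psub (s : T -> P) x :
  pcvg F s x -> pnorm (psub (s t) x) @[t --> F] --> (0 : R).
Proof.
move=> sx; rewrite -(pnorm_psubxx x); apply: (cvg_pnorm (s := fun t => psub (s t) x)).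
by move=> mu; apply: mcvgB => //; exact: mcvg_cst.
Qed.

Lemma pcvg_close (s x : T -> P) l :
  (forall eps : R, 0 < eps -> \forall t \near F, pnorm (psub (s t) (x t)) < eps) ->
  pcvg F x l -> pcvg F s l.
Proof.
move=> sx xl mu.
have -> : (fun t => s t mu) = (fun t => psub (s t) (x t) mu + x t mu).
  by apply/funext => t; rewrite /psub subrK.
rewrite -[X in mcvg _ _ X]add0r; apply: mcvgD (xl mu) => i j; rewrite mxE.
apply/cvgr0Pnorm_lt => e e0; apply: filterS (sx e e0) => t.
exact/le_lt_trans/normr_le_pnorm.
Qed.

Lemma pcvg_cst x : pcvg F (fun=> x) x.
Proof. by move=> mu; exact: mcvg_cst. Qed.

Lemma pcvg_pwith (s : T -> P) x mu q l :
  pcvg F s x -> mcvg F q l -> pcvg F (fun t => pwith (s t) mu (q t)) (pwith x mu l).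
Proof.
move=> sx ql nu; case: (eqVneq mu nu) => [<-|mn].
  by rewrite pwith_in; under eq_fun do rewrite pwith_in.
by rewrite pwith_out//; under eq_fun do rewrite pwith_out//; exact: sx.
Qed.

End PCvg.

Lemma ultra_pcvg T (F : set_system T) {UF : UltraFilter F} (s : T -> P) (C : R) :
  (\forall t \near F, pnorm (s t) <= C) -> exists x, pcvg F s x.
Proof.
move=> sC; apply: (@fin_all_exists _ _ (fun mu => mcvg F (fun t => s t mu))) => mu.
apply: (@ultra_mcvg _ _ F _ _ _ _ C); apply: filterS sC => t st i j.
exact: le_trans (normr_le_pnorm _ _ _) st.
Qed.

Section Multilinear.
Context {N : nat} (U : P -> 'cV[R]_N).
Hypothesis mlU : multilinear U.

Lemma multilinear_Wmat p mu q : U (pwith p mu q) = Wmat U mu p *m q.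
Proof.
have U0 : U (pwith p mu 0) = 0.
  (* With factor -1 and both vectors zero, multilinearity makes the value equal to its negative plus
     itself. *)
  by have := @mlU p mu (-1) 0 0; rewrite scaler0 addr0 scaleN1r addNr.
have UD (I : Type) (r : seq I) (a : I -> R) f : U (pwith p mu (\sum_(i <- r) a i *: f i)) =
    \sum_(i <- r) a i *: U (pwith p mu (f i)).
  by elim: r => [|i r IH]; rewrite ?big_nil// !big_cons mlU IH.
have {1}-> : q = \sum_j q j 0 *: delta_mx j 0.
  by rewrite [LHS]matrix_sum_delta; apply: eq_bigr => j _; rewrite big_ord1.
rewrite UD; apply/matrixP => i j; rewrite ord1 summxE mxE; apply: eq_bigr => k _.
by rewrite !mxE mulrC.
Qed.

Lemma multilinear_Wmat_id p mu : U p = Wmat U mu p *m p mu.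
Proof. by rewrite -multilinear_Wmat pwith_id. Qed.

(** Induction on the number [m] of components that may vary: the last of them is split off as a
    vector multiplied by [Wmat], whose columns are values of [U] with that component frozen at a
    basis vector. *)
Lemma mcvg_multilinear T (F : set_system T) {FF : Filter F} (s : T -> P) x :
  pcvg F s x -> mcvg F (fun t => U (s t)) (U x).
Proof.
suff H m : forall (s' : T -> P) x', pcvg F s' x' ->
    (forall t (nu : 'I_L), (m <= nu)%N -> s' t nu = x' nu) ->
    mcvg F (fun t => U (s' t)) (U x').
  by move=> sx; apply: (H L) => // t nu; rewrite leqNgt ltn_ord.
elim: m => [|m IH] s' x' sx sm.
  have -> : (fun t => U (s' t)) = fun=> U x'; last exact: mcvg_cst.
  by apply/funext => t; congr U; apply: functional_extensionality_dep => nu; exact: sm.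
have [Lm|mL] := leqP L m.
  by apply: IH => // t nu mnu; have := leq_trans Lm mnu; rewrite leqNgt ltn_ord.
pose mu := Ordinal mL; rewrite (multilinear_Wmat_id x' mu).
under eq_fun do rewrite (multilinear_Wmat_id _ mu).
apply: mcvgM; last exact: sx.
move=> i j; under eq_fun do rewrite mxE; rewrite mxE.
apply: (IH (fun t => pwith (s' t) mu _)) => [|t nu mnu].
  by apply: pcvg_pwith => //; exact: mcvg_cst.
case: (eqVneq mu nu) => [<-|mn]; rewrite ?pwith_in// !pwith_out//.
by apply: sm; rewrite ltn_neqAle mnu andbT.
Qed.

Lemma mcvg_Wmat T (F : set_system T) {FF : Filter F} (s : T -> P) x mu :
  pcvg F s x -> mcvg F (fun t => Wmat U mu (s t)) (Wmat U mu x).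
Proof.
move=> sx i j; under eq_fun do rewrite mxE; rewrite mxE.
by apply: mcvg_multilinear; apply: pcvg_pwith => //; exact: mcvg_cst.
Qed.

End Multilinear.
End ParameterTuples.

(** * Vanishing partial gradients give a critical point *)

Section CriticalParameters.
Local Open Scope classical_set_scope.
Context {R : realType} {L : nat} {n : 'I_L -> nat} {N : nat}.
Local Notation P := (@param R L n).
Context (A : 'M[R]_N) (b : 'cV[R]_N) (U : P -> 'cV[R]_N).
Hypothesis Asym : A^T = A.
Hypothesis mlU : multilinear U.

(* Moving the components from [p] to [p + h] one at a time writes the increment
   of [F] as the sum of [ip (theta nu h) (h nu)] over [nu], where [theta nu h]
   tends to the partial gradient at [p]. *)
Lemma critical_param_of_gradient p :
  (forall nu, (Wmat U nu p)^T *m (A *m U p - b) = 0) -> critical_param (Fobj A b U) p.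
Proof.
move=> grad0.
(* The neighbourhoods of zero for [pnorm], so that a limit along [F0] yields the required
   [delta]. *)
pose F0 : set_system P := filter_from [set d : R | 0 < d] (fun d => [set h | pnorm h < d]).
have FF0 : Filter F0.
  apply: filter_from_filter; first by exists 1 => /=.
  move=> d e /= d0 e0; exists (Num.min d e); first by rewrite /= lt_min d0.
  by move=> h /=; rewrite lt_min => /andP.
have h0 (mu : 'I_L) : mcvg F0 (fun h : P => h mu) 0.
  move=> i j; rewrite mxE; apply/cvgr0Pnorm_lt => e e0; exists e => // h /=.
  exact/le_lt_trans/normr_le_pnorm.
(* [x m h] has its first [m] components moved, hence runs from [p] to [padd p h]. *)
pose x (m : nat) (h : P) : P := fun nu => if (nu < m)%N then p nu + h nu else p nu.
have xp m : pcvg F0 (x m) p.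
  move=> nu; rewrite /x; case: (nu < m)%N; last exact: mcvg_cst.
  by rewrite -[X in mcvg _ _ X]addr0; apply: mcvgD => //; exact: mcvg_cst.
pose D h := U (x L h) - U p.
have D0 : mcvg F0 D 0.
  rewrite -(subrr (U p)); apply: mcvgB; last exact: mcvg_cst.
  exact: mcvg_multilinear.
have DE h : D h = \sum_(nu < L) Wmat U nu (x nu h) *m h nu.
  have -> : D h = U (x L h) - U (x 0%N h) by [].
  rewrite -(@telescope_sumr _ 0%N L (fun m => U (x m h)))// big_mkord.
  apply: eq_bigr => nu _.
  have -> : x nu.+1 h = pwith (x nu h) (p nu + h nu).
    apply/esym/pwith_eq; first by rewrite /x ltnSn.
    by move=> mu; rewrite eq_sym -val_eqE /= /x ltnS ltn_neqAle => ->.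
  have {2}-> : x nu h = pwith (x nu h) (p nu).
    by apply/esym/pwith_eq => //; rewrite /x ltnn.
  by rewrite !multilinear_Wmat// mulmxDr addrC addrA addNr add0r.
(* The increment of the quadratic [f] is exactly its linear term plus half its quadratic term; both
   are pulled back to component [nu] by the transpose. *)
pose theta (nu : 'I_L) h :=
  (Wmat U nu (x nu h))^T *m ((ip b b)^-1 *: (2^-1 *: (A *m D h) + (A *m U p - b))).
have theta0 nu : mcvg F0 (theta nu) 0.
  have -> : 0 = (Wmat U nu p)^T *m
      ((ip b b)^-1 *: (2^-1 *: (A *m 0) + (A *m U p - b))) :> 'cV[R]_(n nu).
    by rewrite mulmx0 scaler0 add0r -scalemxAr grad0 scaler0.
  apply: mcvgM; first by apply: mcvgT; exact: mcvg_Wmat.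
  apply: mcvgZ; first exact: cvg_cst.
  apply: mcvgD; last exact: mcvg_cst.
  apply: mcvgZ; first exact: cvg_cst.
  by apply: mcvgM => //; exact: mcvg_cst.
(* Entries of [h] are at most [pnorm h], so [S h * pnorm h] dominates the increment of [F]. *)
pose S h := \sum_(nu < L) \sum_i `|theta nu h i 0|.
have S0 : S h @[h --> F0] --> (0 : R).
  have -> : 0 = \sum_(nu < L) \sum_(i < n nu) `|(0 : 'cV[R]_(n nu)) i 0|.
    by rewrite big1// => nu _; rewrite big1// => i _; rewrite mxE normr0.
  by apply: cvg_sumr => nu _; apply: cvg_sumr => i _; apply: cvg_norm; exact: theta0.
have FE h : Fobj A b U (padd p h) - Fobj A b U p = \sum_(nu < L) ip (theta nu h) (h nu).
  rewrite /Fobj; have -> : U (padd p h) = U p + D h.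
    rewrite /D addrC subrK; congr U; apply: functional_extensionality_dep => nu.
    by rewrite /x ltn_ord.
  under eq_bigr do rewrite /theta ip_mul trmxK.
  rewrite -ip_sumr -DE /fobj; move: (D h) (U p) => u v.
  have sA : ip (A *m u) v = ip (A *m v) u by rewrite ip_mul Asym ipC.
  rewrite -mulrBr ipZl mulmxDr !(ipBl, ipDl, ipDr, ipZl) sA; congr (_ * _).
  move: (ip _ _) (ip _ _) (ip _ _) (ip _ _) (ip _ _) => *.
  by lra.
move=> e e0; have [d /= d0 dS] := cvgr_lt _ S0 _ e0.
exists d => // h /dS /= Se; rewrite FE.
apply: (@le_trans _ _ (S h * pnorm h)); last first.
  by rewrite ler_wpM2r ?pnorm_ge0// ltW.
apply: le_trans (ler_norm_sum _ _ _) _; rewrite mulr_suml; apply: ler_sum => nu _.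
rewrite ipE; apply: le_trans (ler_norm_sum _ _ _) _.
rewrite mulr_suml; apply: ler_sum => i _.
by rewrite normrM ler_wpM2l// normr_le_pnorm.
Qed.

End CriticalParameters.

(** * Accumulation points, index sets and ultrafilters *)

Section Accumulation.
Local Open Scope classical_set_scope.
Context {R : realType}.

Lemma infinite_ultra (J : nat -> bool) : infinite_nat J ->
  exists G : set_system nat, [/\ UltraFilter G, \oo `<=` G & G [set k | J k]].
Proof.
move=> infJ; have PF : ProperFilter (within [set k | J k] \oo).
  apply: Build_ProperFilter_ex => B [K _ KB]; have [k [Kk Jk]] := infJ K.
  by exists k; exact: KB.
have [G [UG sG]] := ultraFilterLemma PF; exists G; split => //.
  by move=> B [K _ KB]; apply: sG; exists K => // k Kk _; exact: KB.
by apply: sG; exists 0%N.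
Qed.

(** [J'] is the range of an increasing sequence [u] with [e (u i) < 1/(i+1)]. The smallness then
    holds along every filter at infinity living on [J'], hence also after any further thinning. *)
Lemma thin_subsequence (J : nat -> bool) (e : nat -> R) :
  (forall eps, 0 < eps -> forall K, exists k, [/\ J k, (K <= k)%N & e k < eps]) ->
  exists J' : nat -> bool, [/\ forall k, J' k -> J k, infinite_nat J' &
    forall G, Filter G -> \oo `<=` G -> G [set k | J' k] ->
      forall eps, 0 < eps -> \forall k \near G, e k < eps].
Proof.
move=> H.
(* The pair holds the precision and a lower bound for the next index. *)
have H' (iK : nat * nat) : exists k, [/\ J k, (iK.2 <= k)%N & e k < iK.1.+1%:R^-1].
  by apply: H; rewrite invr_gt0.
have [f fP] := choice H'.
pose fix u i := if i is i'.+1 then f (i, (u i').+1) else f (0%N, 0%N).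
have uP i : J (u i) /\ e (u i) < i.+1%:R^-1.
  by case: i => [|i]; [have [] := fP (0%N, 0%N)|have [] := fP (i.+1, (u i).+1)].
have uS i : (u i < u i.+1)%N by have [] := fP (i.+1, (u i).+1).
have umono : {homo u : i j / (i < j)%N} by apply: homo_ltn => // ? ? ?; exact: ltn_trans.
have ule : {mono u : i j / (i <= j)%N} by exact: leq_mono.
have uge i : (i <= u i)%N by elim: i => // i IH; exact: leq_ltn_trans (uS i).
exists (fun k => `[< exists i, k = u i >]); split.
- by move=> k /asboolP[i ->]; have [] := uP i.
- by move=> K; exists (u K); split => //; apply/asboolP; exists K.
move=> G FG oG GJ eps eps0.
have [i0 _ i0P] := near_infty_natSinv_lt (interval_inference.PosNum eps0).
have GK : G [set k | (u i0 <= k)%N] by apply: oG; exact: nbhs_infty_ge.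
apply: filterS2 GJ GK => k /asboolP[i ->]; rewrite /= ule => i0i.
have [_ ei] := uP i; apply: lt_trans ei _; exact: i0P.
Qed.

Context {L : nat} {n : 'I_L -> nat}.
Local Notation P := (@param R L n).

Lemma acc_param_subsequence J (s : nat -> P) x : acc_param J s x ->
  exists J' : nat -> bool, [/\ forall k, J' k -> J k, infinite_nat J' &
    forall G, Filter G -> \oo `<=` G -> G [set k | J' k] -> pcvg G s x].
Proof.
move=> /thin_subsequence[J' [sJ iJ GJ]]; exists J'; split => // G FG oG GJ'.
by apply: (pcvg_close (x := fun=> x)) => [e e0|]; [exact: GJ|exact: pcvg_cst].
Qed.

Lemma pcvg_acc_param (G : set_system nat) {PG : ProperFilter G} (J : nat -> bool)
    (s : nat -> P) x :
  \oo `<=` G -> G [set k | J k] -> pcvg G s x -> acc_param J s x.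
Proof.
move=> oG GJ sx e e0 K.
have se : G [set k | pnorm (psub (s k) x) < e].
  by apply: cvgr_lt e0; exact: cvg_pnorm_psub.
have GK : G [set k | (K <= k)%N] by apply: oG; exact: nbhs_infty_ge.
by have [k [[? ?] ?]] := filter_ex (filterI (filterI GJ GK) se); exists k.
Qed.

End Accumulation.

(** * Energy decrease and accumulation points of alternating least squares *)

Section AlternatingLeastSquares.
Local Open Scope classical_set_scope.
Context {R : realType} {L : nat} {n : 'I_L -> nat} {N : nat}.
Local Notation P := (@param R L n).
Context (A : 'M[R]_N) (b : 'cV[R]_N) (U : P -> 'cV[R]_N) (ps : nat -> P).
Hypothesis L_gt0 : (0 < L)%N.
Hypothesis Asym : A^T = A.
Hypothesis Apos : forall v : 'cV[R]_N, v != 0 -> 0 < ip (A *m v) v.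
Hypothesis b_neq0 : b != 0.
Hypothesis mlU : multilinear U.
Hypothesis als : ALS_seq A b U ps.
Hypothesis a2 : A2 U ps.

Let positive (k : nat) : bool := (1 <= k)%N.

Lemma pkmuS k (nu : 'I_L) : pkmu ps k nu.+1 = pwith (pkmu ps k nu) (ps k.+1 nu).
Proof.
apply/esym/pwith_eq; first by rewrite /pkmu ltnSn.
by move=> mu; rewrite eq_sym -val_eqE /= /pkmu ltnS ltn_neqAle => ->.
Qed.

Lemma pkmuL k : pkmu ps k L = ps k.+1.
Proof. by apply: functional_extensionality_dep => nu; rewrite /pkmu ltn_ord. Qed.

Lemma U_pkmuS k (nu : 'I_L) : U (pkmu ps k nu.+1) = Wkmu U ps k nu *m ps k.+1 nu.
Proof. by rewrite pkmuS multilinear_Wmat. Qed.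

Lemma U_pkmu k (nu : 'I_L) : U (pkmu ps k nu) = Wkmu U ps k nu *m ps k nu.
Proof. by rewrite (multilinear_Wmat_id mlU _ nu) /pkmu ltnn. Qed.

Lemma ALS_gradient k (nu : 'I_L) : (1 <= k)%N ->
  (Wkmu U ps k nu)^T *m (A *m U (pkmu ps k nu.+1) - b) = 0.
Proof.
move=> k1; have [X [WX pk]] := als nu k1.
by rewrite U_pkmuS pk; exact: MPinv_normal_eq.
Qed.

Lemma ALS_row_space k (nu : 'I_L) : (1 <= k)%N ->
  exists y, ps k.+1 nu = (Wkmu U ps k nu)^T *m y.
Proof. by move=> k1; have [X [WX ->]] := als nu k1; exact: MPinv_row_space WX _. Qed.

(** The micro-step moves the tensor within the range of [Wkmu], to which the gradient at the new
    tensor is orthogonal. *)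
Lemma ALS_decrease k (nu : 'I_L) : (1 <= k)%N ->
  let D := U (pkmu ps k nu.+1) - U (pkmu ps k nu) in
  Fobj A b U (pkmu ps k nu) - Fobj A b U (pkmu ps k nu.+1)
    = (ip b b)^-1 * (2^-1 * ip (A *m D) D).
Proof.
move=> k1 D; apply: (fobjB Asym (ALS_gradient nu k1) (h := ps k.+1 nu - ps k nu)).
by rewrite U_pkmuS U_pkmu mulmxBr.
Qed.

Lemma Fobj_pkmuS_le k (nu : 'I_L) : (1 <= k)%N ->
  Fobj A b U (pkmu ps k nu.+1) <= Fobj A b U (pkmu ps k nu).
Proof.
move=> k1; rewrite -subr_ge0 ALS_decrease//.
by rewrite !mulr_ge0 ?invr_ge0 ?ip_ge0// ipA_ge0.
Qed.

Lemma Fobj_pkmu_le k m m' : (1 <= k)%N -> (m <= m')%N -> (m' <= L)%N ->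
  Fobj A b U (pkmu ps k m') <= Fobj A b U (pkmu ps k m).
Proof.
move=> k1; elim: m' => [|m' IH]; first by rewrite leqn0 => /eqP ->.
rewrite leq_eqVlt => /orP[/eqP -> //|mm' m'L].
exact: le_trans (Fobj_pkmuS_le (Ordinal m'L) k1) (IH mm' (ltnW m'L)).
Qed.

(** Each decrease is at most that of the whole sweep, and the values after full sweeps form a
    nonincreasing sequence bounded below. *)
Lemma Fobj_decrease_cvg0 (nu : 'I_L) :
  Fobj A b U (pkmu ps k nu) - Fobj A b U (pkmu ps k nu.+1) @[k --> \oo] --> (0 : R).
Proof.
(* The shift keeps all indices at least 1, where the iteration is specified. *)
pose a k := Fobj A b U (ps k.+1).
have aS k : a k.+1 <= a k.
  by have := @Fobj_pkmu_le k.+1 0 L; rewrite pkmuL; apply.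
have ca : cvgn a.
  apply: nonincreasing_is_cvgn; first exact/nonincreasing_seqP.
  have [c cP] := fobj_bounded b Asym Apos.
  by exists c => _ [k _ <-]; exact: cP.
have d0 : a k - a k.+1 @[k --> \oo] --> (0 : R).
  by rewrite -(subrr (limn a)); apply: cvgB => //; rewrite cvg_shiftS.
rewrite -cvg_shiftS; apply: (squeeze_cvgr _ (cvg_cst 0) d0).
apply: nearW => k; rewrite subr_ge0 Fobj_pkmuS_le//=.
apply: lerB; last by rewrite /a -pkmuL; exact: Fobj_pkmu_le.
by have := @Fobj_pkmu_le k.+1 0 nu; apply => //; exact: ltnW.
Qed.

Section Limits.
Context (G : set_system nat) {UG : UltraFilter G}.
Hypothesis oG : \oo `<=` G.

Let G_pos : G [set k | (1 <= k)%N].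
Proof. by apply: oG; exact: nbhs_infty_ge. Qed.

(** The decrease of [F] tends to zero and is a positive multiple of the squared [A]-norm of the
    change, so the limiting change is zero. *)
Lemma U_limitS (nu : 'I_L) x y :
  pcvg G (fun k => pkmu ps k nu) x -> pcvg G (fun k => pkmu ps k nu.+1) y -> U y = U x.
Proof.
move=> cx cy; apply/eqP; rewrite -subr_eq0; apply/eqP; apply: ipA_eq0 Apos _ _.
pose D k := U (pkmu ps k nu.+1) - U (pkmu ps k nu).
have cD : mcvg G D (U y - U x) by apply: mcvgB; exact: mcvg_multilinear.
pose e v := (ip b b)^-1 * (2^-1 * ip (A *m v) v).
have c1 : e (D k) @[k --> G] --> e (U y - U x).
  apply: cvgM; [exact: cvg_cst|apply: cvgM; first exact: cvg_cst].
  by apply: cvg_ip => //; apply: mcvgM => //; exact: mcvg_cst.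
have c2 : e (D k) @[k --> G] --> (0 : R).
  have : Fobj A b U (pkmu ps k nu) - Fobj A b U (pkmu ps k nu.+1) @[k --> G] --> (0 : R).
    by move=> B /(Fobj_decrease_cvg0 nu) /oG.
  apply: cvg_trans; apply: near_eq_cvg; apply: filterS G_pos => k /= k1.
  by rewrite ALS_decrease.
have /eqP : e (U y - U x) = 0 by exact: norm_cvg_unique c1 c2.
rewrite !mulf_eq0 !invr_eq0 pnatr_eq0 /=.
by rewrite (gt_eqF (ip_gt0 b_neq0)) /= => /eqP.
Qed.

(** Every [p_(k,m)] mixes components of [ps k.+1] and [ps k], so the limits of these two give all
    the others. *)
Lemma ALS_limits : exists2 X : nat -> P,
  forall m, pcvg G (fun k => pkmu ps k m) (X m) &
  forall m, (m <= L)%N -> U (X m) = U (X 0%N).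
Proof.
have [[C psC] _] := a2.
have [x cx] : exists x, pcvg G ps x.
  by apply: (@ultra_pcvg _ _ _ _ _ _ _ C); apply: filterS G_pos => k /psC.
have [y cy] : exists y, pcvg G (fun k => ps k.+1) y.
  by apply: (@ultra_pcvg _ _ _ _ _ _ _ C); apply: filterS G_pos => k _; exact: psC.
pose X m : P := fun nu => if (nu < m)%N then y nu else x nu.
have cX m : pcvg G (fun k => pkmu ps k m) (X m).
  by move=> nu; rewrite /pkmu /X; case: (nu < m)%N; [exact: cy|exact: cx].
exists X => //; elim=> // m IH mL.
by rewrite -(IH (ltnW mL)); exact: (@U_limitS (Ordinal mL)).
Qed.

Lemma U_limit m m' x y : (m <= L)%N -> (m' <= L)%N ->
  pcvg G (fun k => pkmu ps k m) x -> pcvg G (fun k => pkmu ps k m') y -> U x = U y.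
Proof.
move=> mL m'L cx cy; have [X cX UX] := ALS_limits.
by rewrite (pcvg_unique cx (cX m)) (pcvg_unique cy (cX m')) !UX.
Qed.

End Limits.

Definition ALS_acc (m : nat) (x : P) : Prop :=
  acc_param positive (fun k => pkmu ps k m) x.

(** The end of sweep [k] is the beginning of sweep [k+1]. *)
Lemma ALS_accL x : ALS_acc L x -> ALS_acc 0 x.
Proof.
move=> xL e e0 K; have [k [k1 Kk xk]] := xL e e0 K.
by exists k.+1; split => //; [exact: leqW|rewrite pkmuL in xk].
Qed.

(** A minimising sequence of accumulation points is followed diagonally by members of [s]; its limit
    is again an accumulation point, represents [w] by continuity and attains the infimum. *)
Lemma acc_param_min (s : nat -> P) w : (exists2 x, acc_param positive s x & U x = w) ->
  exists2 x, acc_param positive s x /\ U x = w &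
    forall q, acc_param positive s q -> U q = w -> pnorm x <= pnorm q.
Proof.
move=> [x0 sx0 Ux0].
pose E : set R := [set pnorm x | x in [set x | acc_param positive s x /\ U x = w]].
have hE : has_inf E.
  split; first by exists (pnorm x0), x0.
  by exists 0 => _ [x _ <-]; exact: pnorm_ge0.
have H (i : nat) : exists xk : P * nat, [/\ U xk.1 = w, pnorm xk.1 < inf E + i.+1%:R^-1,
    (i < xk.2)%N & pnorm (psub (s xk.2) xk.1) < i.+1%:R^-1].
  have i0 : 0 < i.+1%:R^-1 :> R by rewrite invr_gt0.
  have [_ [x [sx Ux] <-] xE] := inf_adherent i0 hE.
  by have [k [_ ik xk]] := sx _ i0 i.+1; exists (x, k).
have [f fP] := choice H.
have small (e : R) : 0 < e -> \forall i \near \oo, i.+1%:R^-1 < e.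
  by move=> e0; exact: (near_infty_natSinv_lt (interval_inference.PosNum e0)).
have [|G [UG oG _]] := @infinite_ultra predT; first by move=> K; exists K.
have [x fx] : exists x, pcvg G (fun i => (f i).1) x.
  apply: (@ultra_pcvg _ _ _ _ _ _ _ (inf E + 1)).
  apply: oG; exists 0%N => // i _; have [_ /ltW fE _ _] := fP i.
  by apply: le_trans fE _; rewrite lerD2l invf_le1// ler1n.
have sx : pcvg G (fun i => s (f i).2) x.
  apply: pcvg_close fx => e e0; apply: oG; apply: filterS (small e e0) => i.
  by have [_ _ _] := fP i; exact: lt_trans.
have Ux : U x = w.
  apply: (@mcvg_unique _ _ G); first exact: mcvg_multilinear fx.
  apply: (@mcvg_near _ _ G _ _ _ (fun=> w)); last exact: mcvg_cst.
  by apply: nearW => i; have [] := fP i.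
exists x; first split => //.
  move=> e e0 K.
  have se : G [set i | pnorm (psub (s (f i).2) x) < e].
    by apply: cvgr_lt e0; exact: cvg_pnorm_psub.
  have GK : G [set i | (K <= i)%N] by apply: oG; exact: nbhs_infty_ge.
  have [i [Ki si]] := filter_ex (filterI GK se); exists (f i).2.
  have [_ _ ik _] := fP i; split => //; first exact: leq_ltn_trans ik.
  exact: leq_trans Ki (ltnW ik).
move=> q sq Uq; apply: (@le_trans _ _ (inf E)); last first.
  by apply: ge_inf; [case: hE|exists q].
apply/ler_addgt0Pr => e e0; apply: (cvgr_to_le (cvg_pnorm fx)).
apply: oG; apply: filterS (small e e0) => i ie; have [_ /ltW fE _ _] := fP i.
by apply: le_trans fE _; rewrite lerD2l ltW.
Qed.

(** * Criticality of an accumulation point of minimal norm *)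

Section MinimalAccumulationPoint.
Context (w : 'cV[R]_N) (x : P).
Hypothesis Ux : U x = w.
Hypothesis x_min : forall q (mu : 'I_L), ALS_acc mu q -> U q = w -> pnorm x <= pnorm q.

(** Position [L], absent from [x_min], wraps round to position 0. *)
Lemma pnorm_min m q : (m <= L)%N -> ALS_acc m q -> U q = w -> pnorm x <= pnorm q.
Proof.
rewrite leq_eqVlt => /orP[/eqP -> /ALS_accL aq|mL aq]; last exact: (x_min (mu := Ordinal mL)).
exact: (x_min (mu := Ordinal L_gt0)).
Qed.

(* Minimality over all accumulation points representing [w], not just those of
   one subsequence, lets the rank condition of (A2) be applied again after each
   micro-step. *)
Lemma ALS_acc_step (nu : 'I_L) : ALS_acc nu x ->
  (Wmat U nu x)^T *m (A *m w - b) = 0 /\ ALS_acc nu.+1 x.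
Proof.
move=> /acc_param_subsequence[J [Jpos infJ Jx]].
have [G [UG oG GJ]] := infinite_ultra infJ.
have cx : pcvg G (fun k => pkmu ps k nu) x by exact: Jx.
have Gpos : G [set k | (1 <= k)%N] by apply: oG; exact: nbhs_infty_ge.
have xJ : ApJ ps J x by exists nu; exact: pcvg_acc_param cx.
(* Along a subset of [J] on which [q] is reached, [p_(k,nu)] still tends to [x]; hence [U q = U x],
   and [x_min] applies. *)
have xJ_min q : ApJ ps J q -> pnorm x <= pnorm q.
  move=> [mu aq]; apply: (x_min (mu := mu)).
    by move=> e e0 K; have [k [/Jpos ? ? ?]] := aq e e0 K; exists k.
  have [J' [J'J infJ' J'q]] := acc_param_subsequence aq.
  have [H [UH oH HJ']] := infinite_ultra infJ'.
  rewrite -Ux; apply: (U_limit oH (ltnW (ltn_ord mu)) (ltnW (ltn_ord nu))).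
    exact: J'q.
  by apply: Jx => //; apply: filterS HJ' => k /J'J.
have [_ /(_ J Jpos infJ x xJ xJ_min nu)[k0 [_ rk]]] := a2.
have [X cX _] := ALS_limits oG.
(* [p_(k,L)] is [ps k.+1], so [y] is the limit of the updated component. *)
pose y := X L nu.
have cy : mcvg G (fun k => ps k.+1 nu) y.
  by have := cX L nu; under eq_fun do rewrite pkmuL.
have cxy : pcvg G (fun k => pkmu ps k nu.+1) (pwith x y).
  by under eq_fun do rewrite pkmuS; exact: pcvg_pwith.
have Uxy : U (pwith x y) = w.
  by rewrite -Ux; apply: (U_limit oG (m := nu.+1) (m' := nu)) => //; exact: ltnW.
have cW : mcvg G (fun k => Wkmu U ps k nu) (Wmat U nu x) by exact: mcvg_Wmat.
have grad0 : (Wmat U nu x)^T *m (A *m w - b) = 0.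
  apply: (@mcvg_unique _ _ G); last exact: mcvg_cst.
  have c : mcvg G (fun k => (Wkmu U ps k nu)^T *m (A *m U (pkmu ps k nu.+1) - b))
      ((Wmat U nu x)^T *m (A *m w - b)).
    rewrite -Uxy; apply: mcvgM; first exact: mcvgT.
    apply: mcvgB; last exact: mcvg_cst.
    by apply: mcvgM; [exact: mcvg_cst|exact: mcvg_multilinear].
  by apply: mcvg_near c; apply: filterS Gpos => k; exact: ALS_gradient.
split => //.
have [z yz] : exists z, y = (Wmat U nu x)^T *m z.
  apply: row_space_limit cW cy _ _; last by apply: filterS Gpos => k; exact: ALS_row_space.
  have Gk0 : G [set k | (k0 <= k)%N] by apply: oG; exact: nbhs_infty_ge.
  by apply: filterS2 GJ Gk0 => k; exact: rk.
pose d := y - x nu.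
(* Old and new component represent the same tensor [w], so [d] is in the kernel of [Wmat U nu x],
   orthogonal to the row space containing [y]. *)
have yd : ip y d = 0.
  rewrite yz ip_mul trmxK /d mulmxBr -multilinear_Wmat// -multilinear_Wmat_id//.
  by rewrite Uxy Ux subrr ip0r.
have xd : ip (x nu) (x nu) = ip y y + ip d d.
  have -> : x nu = y - d by rewrite /d opprB addrC subrK.
  by clearbody d; rewrite !(ipBl, ipBr) (ipC d y) yd; ring.
have axy : ALS_acc nu.+1 (pwith x y) by exact: pcvg_acc_param cxy.
(* [pwith x y] competes with [x] and differs from it only in component [nu], where by Pythagoras it
   is shorter unless [d = 0]. *)
have d0 : d = 0.
  have := pnorm_min (ltn_ord nu) axy Uxy.
  rewrite -(ler_pXn2r (n := 2))// ?nnegrE ?pnorm_ge0// !pnorm_sqr.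
  rewrite (bigD1 nu)//= [X in _ <= X](bigD1 nu)//= pwith_in.
  under [X in _ <= _ + X]eq_bigr => mu mn do rewrite pwith_out 1?eq_sym//.
  rewrite lerD2r xd gerDl => d_le0; apply: ip_eq0; apply/eqP.
  by rewrite eq_le d_le0 ip_ge0.
have xy : y = x nu by apply/eqP; rewrite -subr_eq0 -/d d0.
by move: axy; rewrite xy pwith_id.
Qed.

(** The steps carry [x] from [nu] to the end of the sweep, hence to the start of the next, and from
    there to every [mu], where the partial gradient vanishes. *)
Lemma ALS_min_critical (nu : 'I_L) : ALS_acc nu x -> critical_param (Fobj A b U) x.
Proof.
move=> ax.
have up m m' : (m <= m')%N -> (m' <= L)%N -> ALS_acc m x -> ALS_acc m' x.
  elim: m' => [|m' IH]; first by rewrite leqn0 => /eqP ->.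
  rewrite leq_eqVlt => /orP[/eqP -> //|mm' m'L am].
  by have [] := @ALS_acc_step (Ordinal m'L) (IH mm' (ltnW m'L) am).
have ax0 : ALS_acc 0 x by apply: ALS_accL; apply: up ax => //; exact: ltnW.
apply: critical_param_of_gradient => // mu; rewrite Ux.
by have [] := ALS_acc_step (up 0%N mu isT (ltnW (ltn_ord mu)) ax0).
Qed.

End MinimalAccumulationPoint.

Lemma ALS_acc_vec_critical w : acc_vec (fun k => U (ps k)) w -> critset A b U w.
Proof.
move=> /thin_subsequence[J [Jpos infJ Jw]].
have [G [UG oG GJ]] := infinite_ultra infJ.
have cw : mcvg G (fun k => U (ps k)) w.
  move=> i j; apply/cvgrPdist_lt => e e0; apply: filterS (Jw G _ oG GJ e e0) => k.
  apply: le_lt_trans; rewrite distrC.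
  by have := normr_le_vnorm (U (ps k) - w) i j; rewrite !mxE.
have [X cX UX] := ALS_limits oG.
have X0w : U (X 0%N) = w.
  by apply: (mcvg_unique _ cw); apply: mcvg_multilinear (cX 0%N).
have ex (mu : 'I_L) : exists2 x, ALS_acc mu x & U x = w.
  exists (X mu); last by rewrite UX// (ltnW (ltn_ord mu)).
  by apply: pcvg_acc_param (cX mu) => //; apply: oG; exact: nbhs_infty_ge.
have [Y YP] := fin_all_exists (fun mu => let: ex_intro2 x xP xq := acc_param_min (ex mu) in
  ex_intro (fun x => _ /\ _) x (conj xP xq)).
(* The least of the [L] positionwise minima is minimal over all positions of the sweep at once. *)
pose nu := [arg min_(i < Ordinal L_gt0) pnorm (Y i)]%O.
have Ynu mu : pnorm (Y nu) <= pnorm (Y mu).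
  by rewrite /nu; case: arg_minP => // i _; apply.
have [[anu Unu] _] := YP nu.
exists (Y nu); split; first by rewrite Unu.
apply: (ALS_min_critical Unu _ anu) => q mu aq Uq.
by have [_ Ymin] := YP mu; exact: le_trans (Ynu mu) (Ymin q aq Uq).
Qed.

(** Otherwise infinitely many [k] stay away from all critical points; an ultrafilter on them gives
    an accumulation point of the tensors, which is critical. *)
Lemma ALS_dist_critical (eps : R) : 0 < eps -> exists K : nat, forall k, (K <= k)%N ->
  exists2 w, critset A b U w & vnorm (U (ps k) - w) < eps.
Proof.
move=> e0; apply: contrapT => /forallNP noK.
pose far k := ~ exists2 w, critset A b U w & vnorm (U (ps k) - w) < eps.
have [|G [UG oG Gfar]] := @infinite_ultra (fun k => `[< far k >]).
  move=> K; have /existsNP[k /not_implyP[Kk fk]] := noK K.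
  by exists k; split => //; exact/asboolP.
have [X cX _] := ALS_limits oG.
have cU : mcvg G (fun k => U (ps k)) (U (X 0%N)) by apply: mcvg_multilinear (cX 0%N).
have near0 (e : R) : 0 < e -> G [set k | vnorm (U (ps k) - U (X 0%N)) < e].
  move=> e0'; apply: cvgr_lt e0'.
  have -> : 0 = vnorm (U (X 0%N) - U (X 0%N)) :> R by rewrite subrr /vnorm ip0r sqrtr0.
  apply: (@continuous_cvg _ _ _ G _ _ Num.sqrt); first exact: sqrt_continuous.
  by apply: cvg_ip; apply: mcvgB => //; exact: mcvg_cst.
have aU : acc_vec (fun k => U (ps k)) (U (X 0%N)).
  move=> e e1 K.
  have GK : G [set k | (maxn 1 K <= k)%N] by apply: oG; exact: nbhs_infty_ge.
  have [k [/= Kk ek]] := filter_ex (filterI GK (near0 e e1)).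
  by exists k; move: Kk; rewrite geq_max => /andP[].
have [k [/asboolP fk ek]] := filter_ex (filterI Gfar (near0 eps e0)).
by apply: fk; exists (U (X 0%N)) => //; exact: ALS_acc_vec_critical.
Qed.

End AlternatingLeastSquares.

(** The limit of distances is unfolded: an infimum below [eps] means that some critical [w] lies
    within [eps], which also shows that critical points exist. *)
Theorem mainTheorem1 (R : realType) (d : nat) (m : 'I_d -> nat) (N : nat)
  (L : nat) (n : 'I_L -> nat)
  (A : 'M[R]_N) (b : 'cV[R]_N) (U : @param R L n -> 'cV[R]_N) (ps : nat -> @param R L n) :
  (1 <= d)%N -> (forall i, (0 < m i)%N) -> N = (\prod_(i < d) m i)%N ->
  (d <= L)%N ->
  A^T = A -> (forall v : 'cV[R]_N, v != 0 -> 0 < ip (A *m v) v) ->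
  b != 0 ->
  multilinear U ->
  ALS_seq A b U ps ->
  A2 U ps ->
  (forall w : 'cV[R]_N, acc_vec (fun k => U (ps k)) w -> critset A b U w) /\
  (forall eps : R, 0 < eps -> exists K : nat, forall k : nat, (K <= k)%N ->
     exists2 w : 'cV[R]_N, critset A b U w & vnorm (U (ps k) - w) < eps).
Proof.
move=> d_gt0 _ _ dL Asym Apos b0 mlU als a2.
have L_gt0 : (0 < L)%N := leq_trans d_gt0 dL.
split; first exact: ALS_acc_vec_critical.
by move=> eps; exact: ALS_dist_critical.
Qed.
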